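(* For a regular Hausdorff space $X$ the following are equivalent: (1) $X$ has a point-countable base; (2) $\mathcal{F}_2(X)$ is a Fréchet–Urysohn space with a point-countable $k$-network; (3) $\mathcal{K}(X)$ is a Fréchet–Urysohn space with a point-countable $k$-network; (4) $\mathcal{K}(X)$ has a point-countable weak base; (5) $\mathcal{K}(X)$ has a compact-countable weak base; (6) $\mathcal{K}(X)$ has a point-countable base.
   Context: $\mathcal{K}(X)$ is the set of nonempty compact subsets of $X$ with the Vietoris topology (base: $\langle U_1,\dots,U_k\rangle=\{K: K\subset\bigcup_i U_i,\ K\cap U_j\neq\emptyset\ \forall j\}$, $U_i$ open in $X$), and $\mathcal{F}_2(X)$ is its subspace of subsets of cardinality at most 2. A $k$-network is a family $\mathcal{P}$ such that for every compact $K$ and open $U\supset K$ some finite $\mathcal{P}'\subset\mathcal{P}$ has $K\subset\bigcup\mathcal{P}'\subset U$. A weak base for $Y$ is a cover $\mathcal{P}=\bigcup_{y\in Y}\mathcal{P}_y$ such that: for $U,V\in\mathcal{P}_y$ there is $W\in\mathcal{P}_y$ with $W\subset U\cap V$; each member of $\mathcal{P}_y$ contains $y$, and for each open $U\ni y$ some $P\in\mathcal{P}_y$ has $P\subset U$; and a set $G\subset Y$ is open whenever for each $y\in G$ some $P\in\mathcal{P}_y$ satisfies $P\subset G$. A family is point-countable (resp. compact-countable) if each point (resp. each compact set) meets only countably many members. *)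

(* Defs.v *)
From HB Require Import structures.
From mathcomp Require Import all_boot all_order.
From mathcomp Require Import all_classical all_reals all_analysis.

Set Implicit Arguments.
Unset Strict Implicit.
Unset Printing Implicit Defensive.

Local Open Scope classical_set_scope.

(* A "space" is given by a carrier S : set T inside an ambient type T  *)
(* together with its family of open sets op : set T -> Prop (all open  *)
(* sets are subsets of S).  This lets us treat K(X), F_2(X) (which are *)
(* subsets of set X) and X itself uniformly.                          *)

Section Spaces.
Variable T : Type.
Variables (S : set T) (op : set T -> Prop).

Definition union_seq (s : seq (set T)) : set T :=
  [set x | exists2 P, P \in s & P x].

Definition sp_compact (K : set T) : Prop :=
  K `<=` S /\
  forall C : set (set T), (forall U, C U -> op U) -> K `<=` \bigcup_(U in C) U ->
    exists s : seq (set T), (forall U, U \in s -> C U) /\ K `<=` union_seq s.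

Definition sp_base (B : set (set T)) : Prop :=
  (forall P, B P -> op P) /\
  forall U x, op U -> U x -> exists2 P, B P & P x /\ P `<=` U.

Definition point_countable (F : set (set T)) : Prop :=
  forall x, S x -> countable [set P | F P /\ P x].

Definition compact_countable (F : set (set T)) : Prop :=
  forall K, sp_compact K -> countable [set P | F P /\ P `&` K !=set0].

Definition k_network (F : set (set T)) : Prop :=
  (forall P, F P -> P `<=` S) /\
  forall K U, sp_compact K -> op U -> K `<=` U ->
    exists s : seq (set T), (forall P, P \in s -> F P) /\
      K `<=` union_seq s /\ union_seq s `<=` U.

Definition sp_closure (A : set T) : set T :=
  [set x | S x /\ forall U, op U -> U x -> U `&` A !=set0].

Definition sp_converges (u : nat -> T) (x : T) : Prop :=
  forall U, op U -> U x -> exists N, forall n, (N <= n)%N -> U (u n).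

Definition frechet_urysohn : Prop :=
  forall A x, A `<=` S -> sp_closure A x ->
    exists u : nat -> T, (forall n, A (u n)) /\ sp_converges u x.

(* weak base P = \bigcup_{y in S} P_y, given by the assignment y |-> P_y *)
Definition weak_base (Pw : T -> set (set T)) : Prop :=
  (forall y P, S y -> Pw y P -> P `<=` S) /\
  (forall y, S y -> forall U V, Pw y U -> Pw y V ->
      exists2 W, Pw y W & W `<=` U `&` V) /\
  (forall y, S y -> forall P, Pw y P -> P y) /\
  (forall y U, S y -> op U -> U y -> exists2 P, Pw y P & P `<=` U) /\
  (forall G, G `<=` S -> (forall y, G y -> exists2 P, Pw y P & P `<=` G) -> op G).

Definition weak_base_family (Pw : T -> set (set T)) : set (set T) :=
  [set P | exists2 y, S y & Pw y P].

End Spaces.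

Section Hyperspace.
Variable X : topologicalType.

Definition KX : set (set X) := [set K | K !=set0 /\ compact K].

Definition vietoris_basic (s : seq (set X)) : set (set X) :=
  [set K | KX K /\ K `<=` union_seq s /\ forall U, U \in s -> K `&` U !=set0].

Definition vietoris_open (W : set (set X)) : Prop :=
  W `<=` KX /\
  forall K, W K -> exists s : seq (set X), (forall U, U \in s -> open U) /\
     vietoris_basic s K /\ vietoris_basic s `<=` W.

Definition F2X : set (set X) := [set K | exists a b : X, K = [set a; b]].

Definition F2_open (V : set (set X)) : Prop :=
  exists2 W, vietoris_open W & V = W `&` F2X.

End Hyperspace.

(* Main.v *)
Require Import Defs.
From HB Require Import structures.
From mathcomp Require Import all_boot all_order.
From mathcomp Require Import all_classical all_reals all_analysis.
Local Open Scope classical_set_scope.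

(** (2) implies (1): X is Fréchet-Urysohn with a point-countable k-network N.
    If no finite union of members of N inside an open U were a neighbourhood of
    x in U, one could build sequences converging to x which increasingly avoid
    the members of N met by the earlier ones; pairing them with a nontrivial
    sequence converging to x contradicts the Fréchet-Urysohn property of F_2(X).
    Point-countable families with finite interior covers of this kind yield a
    point-countable base (Burke and Michael).

    (4) implies (1): X inherits a weak base from K(X). If a member Q of the weak
    base at some point were not a neighbourhood of it, there would be sequences
    x_n -> x in Q and z_(n,m) -> x_n outside Q. In K(X), the compact sets
    K_0 = {x, x_0, x_1, ...} and K_0 u {z_(n,m)} form a sequential fan. A
    diagonal set of leaves z_(n,d(n)) can be chosen inside the weak
    neighbourhoods of K_0; point-countability allows it to be almost disjoint
    from every relevant member of the weak base, hence closed, which is absurd.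

    (1) implies (6): by Mishchenko's argument a point-countable base is
    compact-countable, so that finite subfamilies of it give a point-countable
    base of K(X). *)

Set Implicit Arguments.
Unset Strict Implicit.
Unset Printing Implicit Defensive.

(** * Finite unions, countable families and dependent choice *)

Section UnionSeq.
Context {T : Type}.
Implicit Types (P : set T) (s t : seq (set T)).

Lemma union_seq_cons P s : union_seq (P :: s) = P `|` union_seq s.
Proof.
apply/seteqP; split => x.
  move=> [Q]; rewrite inE => /predU1P[->|Qs] Qx; first by left.
  by right; exists Q.
move=> [Px|[Q Qs Qx]]; first by exists P => //; rewrite inE eqxx.
by exists Q => //; rewrite inE Qs orbT.
Qed.

Lemma union_seq_subset s t : {subset s <= t} -> union_seq s `<=` union_seq t.
Proof. by move=> st x [P Ps Px]; exists P => //; apply: st. Qed.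

End UnionSeq.

Lemma countable_enum {T : Type} (A : set (set T)) : countable A ->
  exists p : nat -> set T, forall P, A P -> exists i, p i = P.
Proof.
move=> /pcard_surjP[g gA]; exists g => P /gA[i _ <-]; by exists i.
Qed.

Lemma countable_sub {T : Type} (A B : set T) : A `<=` B -> countable B -> countable A.
Proof. by move=> /subset_card_le; exact: sub_countable. Qed.

Lemma countable_image {T U : Type} (f : T -> U) (A : set T) :
  countable A -> countable (f @` A).
Proof. exact/sub_countable/card_image_le. Qed.

Lemma countable_mem {T : eqType} (s : seq T) : countable [set x | x \in s].
Proof. exact/finite_set_countable/finite_seq. Qed.

Lemma history_choice {T : Type} (R : seq T -> T -> Prop) :
  (forall h, exists t, R h t) -> exists f : nat -> T, forall n, R (mkseq f n) (f n).
Proof.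
move=> /choice[g gP].
pose h := fix h n := if n is m.+1 then rcons (h m) (g (h m)) else [::].
exists (g \o h) => n; suff -> : mkseq (g \o h) n = h n by exact: gP.
by elim: n => // n IHn; rewrite mkseqS IHn.
Qed.

(** * Countably branching trees and Mishchenko's argument *)

Section Tree.
Context {T : choiceType}.
Variable next : seq T -> set T.

Fixpoint tree_level n : set (seq T) :=
  if n is m.+1 then \bigcup_(s in tree_level m) [set P :: s | P in next s]
  else [set [::]].

Definition tree : set (seq T) := \bigcup_n tree_level n.

Lemma tree_nil : tree [::].
Proof. by exists 0. Qed.

Lemma tree_cons s P : tree s -> next s P -> tree (P :: s).
Proof. by move=> [n _ ns] sP; exists n.+1 => //; exists s => //; exists P. Qed.

Lemma tree_countable : (forall s, countable (next s)) -> countable tree.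
Proof.
move=> cn; apply: bigcup_countable => // n _; elim: n => /= [|n IHn].
  exact: countable1.
by apply: bigcup_countable => // s _; exact: countable_image.
Qed.

End Tree.

(* Mishchenko's argument: a sequence that is not yet good can only be extended
   in countably many ways, and every good sequence contains one of these ways. *)
Lemma mishchenko {T : choiceType} (A : set T) (good : seq T -> Prop) :
  (forall s, ~ good s -> exists2 C : set T, countable C &
     forall F, (forall P, P \in F -> A P) -> good F ->
       exists P, [/\ P \in F, P \notin s & C P]) ->
  exists2 S : set (seq T), countable S &
    forall F, (forall P, P \in F -> A P) -> good F ->
      exists s, [/\ S s, {subset s <= F} & good s].
Proof.
move=> H.
have /choice[C HC] (s : seq T) : exists C : set T, countable C /\ (~ good s ->
     forall F, (forall P, P \in F -> A P) -> good F ->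
       exists P, [/\ P \in F, P \notin s & C P]).
  have [gs|ngs] := pselect (good s).
    by exists set0; split=> //; exact: countable0.
  by have [C cC CP] := H s ngs; exists C.
exists (tree C); first by apply: tree_countable => s; exact: (HC s).1.
move=> F AF gF.
(* [n] bounds the number of distinct elements of [F] missing from [s]; each extension of a list that
   is not good uses up one of them. *)
suff: forall n s, tree C s -> uniq s -> {subset s <= F} ->
    (size (undup F) <= n + size s)%N -> exists s, [/\ tree C s, {subset s <= F} & good s].
  move=> /(_ (size (undup F)) [::]); apply => //; first exact: tree_nil.
  by rewrite addn0.
elim=> [|n IHn] s Ts us sF szF; have [gs|ngs] := pselect (good s); try by exists s.
  have [P [PF Ps _]] := (HC s).2 ngs F AF gF.
  have : (size (P :: s) <= size (undup F))%N.
    apply: uniq_leq_size => [|Q]; first by rewrite /= Ps.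
    by rewrite inE mem_undup => /predU1P[->|/sF].
  by move=> /leq_trans/(_ szF); rewrite /= add0n ltnn.
have [P [PF Ps CP]] := (HC s).2 ngs F AF gF.
apply: (IHn (P :: s)) => //=.
- exact: tree_cons.
- by rewrite Ps.
- by move=> Q; rewrite inE => /predU1P[->|/sF].
- by rewrite addnS -addSn.
Qed.

(** * Abstract spaces: consequences of a base, and convergent sequences *)

Record is_topology {T : Type} (S : set T) (op : set T -> Prop) : Prop := IsTopology {
  top_sub : forall U, op U -> U `<=` S;
  topI : forall U V, op U -> op V -> op (U `&` V);
  top_local : forall G, G `<=` S ->
    (forall y, G y -> exists2 U, op U & U y /\ U `<=` G) -> op G;
  topT : op S }.

Section Generic.
Context {T : Type} (S : set T) (op : set T -> Prop).
Hypothesis top : is_topology S op.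

Let top_bigI (U : nat -> set T) n :
  (forall i, op (U i)) -> op (fun x => S x /\ forall i, (i < n)%N -> U i x).
Proof.
move=> opU; elim: n => [|n IHn].
  by rewrite (_ : (fun _ => _) = S); [exact: (topT top)|apply/seteqP; split=> x //= []].
rewrite (_ : (fun _ => _) = (fun x => S x /\ forall i, (i < n)%N -> U i x) `&` U n).
  exact: (topI top).
apply/seteqP; split=> x /=.
  by move=> [Sx Ux]; split=> [|]; [split=> // i /ltnW/Ux|exact: Ux].
move=> [[Sx Ux] Unx]; split=> // i; rewrite ltnS leq_eqVlt => /predU1P[->//|]; exact: Ux.
Qed.

Lemma base_frechet B : sp_base op B -> point_countable S B -> frechet_urysohn S op.
Proof.
move=> [Bop Bb] Bc A x AS [Sx clA].
have [p pP] := countable_enum (Bc x Sx).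
(* Indices that list no base member at [x] get [S], so that every [U i] is an open neighbourhood of
   [x]. *)
pose U i := if `[< B (p i) /\ p i x >] then p i else S.
have opU i : op (U i) by rewrite /U; case: asboolP => [Bp|_]; [exact: Bop Bp.1|exact: (topT top)].
have Ux i : U i x by rewrite /U; case: asboolP => [Bp|_]; [exact: Bp.2|].
have /choice[u uP] n : exists a, A a /\ forall i, (i < n)%N -> U i a.
  by have [|a [[_ Ua] Aa]] := clA _ (top_bigI n opU); [|exists a].
exists u; split=> [n|V opV Vx]; first exact: (uP n).1.
have [P BP [Px PV]] := Bb V x opV Vx.
have [i iP] := pP P (conj BP Px).
exists i.+1 => n ltin; apply: PV; have := (uP n).2 i ltin.
by rewrite /U; case: asboolP => [_|[]]; rewrite iP.
Qed.

Lemma base_k_network B : sp_base op B -> k_network S op B.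
Proof.
move=> [Bop Bb]; split=> [P /Bop|K U [KS Kc] opU KU]; first exact: (top_sub top).
have [||s [sC Ks]] := Kc [set P | B P /\ P `<=` U].
- by move=> P [/Bop].
- move=> x Kx; have [P BP [Px PU]] := Bb U x opU (KU x Kx).
  by exists P.
exists s; split=> [P /sC[]//|]; split=> // x [P /sC[_ PU] Px]; exact: PU.
Qed.

Lemma base_weak_base B : sp_base op B -> weak_base S op (fun y => [set P | B P /\ P y]).
Proof.
move=> [Bop Bb]; do !split.
- by move=> y P Sy [/Bop + _]; exact: (top_sub top).
- move=> y Sy U V [BU Uy] [BV Vy].
  have [W BW [Wy WUV]] := Bb (U `&` V) y (topI top (Bop _ BU) (Bop _ BV)) (conj Uy Vy).
  by exists W.
- by move=> y Sy P [].
- by move=> y U Sy opU Uy; have [P BP [Py PU]] := Bb U y opU Uy; exists P.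
- move=> G GS Gy; apply: (top_local top) => // y /Gy[P [/Bop opP Py] PG].
  by exists P.
Qed.

Definition sp_T1 := forall x y, S x -> S y -> x <> y -> exists2 U, op U & U x /\ ~ U y.

(** There are countably many finite lists such that every finite cover of [K] from [B] contains one
    of them that still covers [K]. A member [P] that meets [K] occurs in one of these lists: it lies
    in a cover where it alone contains some point [x] of [K], and every subcover must keep it. *)
Lemma base_compact_countable B : sp_T1 -> sp_base op B -> point_countable S B ->
  compact_countable S op B.
Proof.
move=> T1 [Bop Bb] Bc K [KS Kc].
have [s nKs|F cF FP] := @mishchenko (set T) B (fun s => K `<=` union_seq s).
  have /nonsubset[x [Kx nsx]] := nKs.
  exists [set P | B P /\ P x]; first by apply: Bc; exact: KS.
  move=> F BF KF; have [P PF Px] := KF x Kx; exists P; split=> //; last by split=> //; exact: BF.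
  by apply/negP => Ps; apply: nsx; exists P.
apply: (@countable_sub _ _ (\bigcup_(s in F) [set P | P \in s])); last first.
  by apply: bigcup_countable => // s _; exact: countable_mem.
move=> P [BP [x [Px Kx]]].
(* By the T1 axiom, points other than [x] have base members that avoid [x]; so only [P] covers [x]
   here. *)
have [||s [sC Ks]] := Kc [set Q | B Q /\ (Q x -> Q = P)].
- by move=> Q [/Bop].
- move=> y Ky; have [->|yx] := pselect (y = x); first by exists P.
  have [U opU [Uy nUx]] := T1 y x (KS y Ky) (KS x Kx) yx.
  have [Q BQ [Qy QU]] := Bb U y opU Uy.
  by exists Q => //; split=> // /QU.
have [|t [Ft ts Kt]] := FP s _ Ks; first by move=> Q /sC[].
exists t => //=; have [Q Qt Qx] := Kt x Kx.
by have [_ /(_ Qx) <-] := sC Q (ts Q Qt).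
Qed.

Lemma compact_countable_point F : compact_countable S op F -> point_countable S F.
Proof.
move=> Fc x Sx; have /Fc : sp_compact S op [set x].
  split=> [y ->//|C Cop /(_ x erefl)[U CU Ux]].
  exists [:: U]; split=> [V|y ->]; first by rewrite inE => /eqP ->.
  by exists U; rewrite ?inE.
by apply: countable_sub => P [FP Px]; split=> //; exists x.
Qed.

Lemma sp_converges_notin (u : nat -> T) x y : sp_T1 -> S x -> S y -> x <> y ->
  sp_converges op u x -> exists N, forall n, (N <= n)%N -> u n <> y.
Proof.
move=> T1 Sx Sy xy ux; have [U opU [Ux nUy]] := T1 x y Sx Sy xy.
by have [N uN] := ux U opU Ux; exists N => n /uN + uny; rewrite uny.
Qed.

Lemma converges_compact (u : nat -> T) x N : S x -> (forall n, S (u n)) ->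
  sp_converges op u x -> sp_compact S op (x |` [set u n | n in [set n | (N <= n)%N]]).
Proof.
move=> Sx Su ux; split=> [y [->//|[n _ <-]//]|C Cop CK].
have [U CU Ux] := CK x (or_introl erefl).
have [M uM] := ux U (Cop U CU) Ux.
suff [s [sC Hs]] : exists s : seq (set T), (forall V, V \in s -> C V) /\
    forall n, (N <= n < M)%N -> union_seq s (u n).
  exists (U :: s); split=> [V|]; first by rewrite inE => /predU1P[->|/sC].
  rewrite union_seq_cons => y [->|[n /= Nn <-]]; first by left.
  by have [/uM|nM] := leqP M n; [left|right; apply: Hs; rewrite Nn].
elim: M {uM} => [|M [s [sC Hs]]]; first by exists [::]; split=> // n; rewrite ltn0 andbF.
have [NM|MN] := leqP N M; last first.
  by exists s; split=> // n /andP[Nn nM]; have := leq_trans (leq_trans MN Nn) nM; rewrite ltnn.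
have [V CV Vu] := CK (u M) (or_intror (ex_intro2 _ _ M NM erefl)).
exists (V :: s); split=> [W|n]; first by rewrite inE => /predU1P[->|/sC].
rewrite union_seq_cons ltnS [(n <= M)%N]leq_eqVlt => /andP[Nn /predU1P[->|nM]]; first by left.
by right; apply: Hs; rewrite Nn.
Qed.

End Generic.

(** * Spaces whose topology is induced by a map *)

Section Pullback.
Context {T' T : Type} (S' : set T') (op' : set T' -> Prop) (S : set T) (op : set T -> Prop).
Variable f : T' -> T.
Hypothesis fS : forall x, S' x -> S (f x).
Hypothesis opE : forall V, op' V <-> exists2 W, op W & V = S' `&` f @^-1` W.

Lemma frechet_pullback : frechet_urysohn S op -> frechet_urysohn S' op'.
Proof.
move=> FU A x AS [Sx clA].
have [||v [Av vx]] := FU (f @` A) (f x).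
- by move=> _ [a /AS/fS + <-].
- split=> [|W opW Wfx]; first exact: fS.
  have [||a [[_ Wa] Aa]] := clA (S' `&` f @^-1` W) => //.
    by apply/opE; exists W.
  by exists (f a); split=> //; exists a.
have /choice[u uP] n : exists a, A a /\ f a = v n by have [a] := Av n; exists a.
exists u; split=> [n|V /opE[W opW VE] Vx]; first exact: (uP n).1.
have [N vN] := vx W opW (eq_ind V (fun V => V x) Vx _ VE).2.
exists N => n /vN; rewrite VE; split; first exact/AS/(uP n).1.
by rewrite /= (uP n).2.
Qed.

Lemma pullback_compact K : sp_compact S' op' K -> sp_compact S op (f @` K).
Proof.
move=> [KS Kc]; split=> [_ [x /KS/fS + <-]//|C Cop CK].
have [||s [sC Ks]] := Kc [set V | exists2 W, C W & V = S' `&` f @^-1` W].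
- by move=> V [W /Cop opW VE]; apply/opE; exists W.
- move=> x Kx; have [|W CW Wfx] := CK (f x); first by exists x.
  by exists (S' `&` f @^-1` W); [exists W|split=> //; exact: KS].
have /choice[g gP] V : exists W, V \in s -> C W /\ V = S' `&` f @^-1` W.
  have [Vs|] := boolP (V \in s); last by exists set0.
  by have [W CW VE] := sC V Vs; exists W.
exists (map g s); split=> [_ /mapP[V Vs ->]|_ [x Kx <-]]; first exact: (gP V Vs).1.
have [V Vs Vx] := Ks x Kx; exists (g V); first exact: map_f.
by move: Vx; rewrite {1}(gP V Vs).2 => -[].
Qed.

Lemma k_network_pullback N : k_network S op N -> point_countable S N ->
  let N' := [set S' `&` f @^-1` P | P in N] in
  k_network S' op' N' /\ point_countable S' N'.
Proof.
move=> [NS Nk] Nc N'; split; [split|].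
- by move=> _ [P _ <-] x [].
- move=> K U Kc /opE[W opW UE] KU.
  have [|s [sN [Ks sW]]] := Nk (f @` K) W (pullback_compact Kc) opW.
    by move=> _ [x /KU + <-]; rewrite UE => -[].
  exists [seq S' `&` f @^-1` P | P <- s]; split=> [_ /mapP[P /sN NP ->]|]; first by exists P.
  split=> [x Kx|x [_ /mapP[P Ps ->] [Sx Px]]].
    have [|P Ps Px] := Ks (f x); first by exists x.
    by exists (S' `&` f @^-1` P); [exact: map_f|split=> //; exact: Kc.1].
  by rewrite UE; split=> //; apply: sW; exists P.
- move=> x Sx.
  apply: (@countable_sub _ _ [set S' `&` f @^-1` P | P in [set P | N P /\ P (f x)]]).
    by move=> _ [[P NP <-] [_ Px]]; exists P.
  by apply: countable_image; exact/Nc/fS.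
Qed.

End Pullback.

(** * Compactness, separation and convergence in [X] *)

Section Topology.
Context {X : topologicalType}.

Lemma open_topology : is_topology [set: X] open.
Proof.
split=> //; [exact: openI| |exact: openT] => G _ GP.
rewrite openE => y /GP[U opU [Uy UG]]; rewrite /interior nbhsE.
by exists U.
Qed.

Lemma hausdorff_sep (x y : X) : hausdorff_space X -> x <> y ->
  exists U V, [/\ open U, open V, U x, V y & U `&` V = set0].
Proof.
move=> H xy; move: (H); rewrite open_hausdorff => /(_ x y)[|[U V] [/= Ux Vy] [oU oV /eqP UV]].
  exact/eqP.
by exists U, V; split=> //; rewrite -in_setE.
Qed.

Lemma hausdorff_openC1 (x : X) : hausdorff_space X -> open (~` [set x]).
Proof.
move=> H; apply: closed_openC.
exact/accessible_closed_set1/hausdorff_accessible.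
Qed.

Lemma open_T1 : hausdorff_space X -> sp_T1 [set: X] open.
Proof.
move=> H x y _ _ xy; exists (~` [set y]); first exact: hausdorff_openC1.
by split=> // /(_ erefl).
Qed.

(** Without a finite subcover, the sets [K] minus finite unions from [C] generate a proper filter.
    Its cluster point would lie in some member of [C], whose complement in [K] belongs to the
    filter. *)
Lemma compact_sp_compact (K : set X) : compact K -> sp_compact setT open K.
Proof.
move=> Kc; split=> // C Cop KC; apply: contrapT => nS.
pose D := [set s : seq (set X) | forall U, U \in s -> C U].
pose F := filter_from D (fun s => K `\` union_seq s).
have PF : ProperFilter F.
  apply: filter_from_proper.
    apply: filter_from_filter; first by exists [::].
    move=> s t Ds Dt; exists (s ++ t) => [U|x [Kx nst]].
      by rewrite mem_cat => /orP[/Ds|/Dt].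
    by split; split=> // -[U Us Ux]; apply: nst; exists U; rewrite // mem_cat Us ?orbT.
  move=> s Ds; apply: contrapT => /set0P/negP; rewrite negbK => /eqP Ks0.
  by apply: nS; exists s; split=> //; rewrite -setD_eq0.
have [|x [Kx Fx]] := Kc F PF; first by exists [::] => // x [].
have [U CU Ux] := KC x Kx.
have [y [[_ nUy] Uy]] : (K `\` union_seq [:: U]) `&` U !=set0.
  apply: Fx; last by apply: open_nbhs_nbhs; split=> //; exact: Cop.
  by exists [:: U] => // V; rewrite inE => /eqP ->.
by apply: nUy; exists U; rewrite ?inE.
Qed.

(** A filter that does not cluster at [x] has a member avoiding a neighbourhood of [x], hence
    contains a finite set of terms [u n], and finite sets are compact. *)
Lemma compact_sequence (u : nat -> X) x : sp_converges open u x -> compact (x |` range u).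
Proof.
move=> ux F PF FK.
have [Fx|/existsNP[A /existsNP[B /not_implyP[FA /not_implyP[xB nAB]]]]] := pselect (cluster F x).
  by exists x; split=> //; left.
move: xB; rewrite nbhsE => -[U [oU Ux] UB].
have [N uN] := ux U oU Ux.
have FN : F (u @` `I_N).
  apply: filterS (filterI FA FK) => y [Ay [yx|[n _ uny]]].
    by exfalso; apply: nAB; exists y; split=> //; apply: UB; rewrite yx.
  exists n => //=; rewrite ltnNge; apply/negP => /uN Uun.
  by apply: nAB; exists y; split=> //; apply: UB; rewrite -uny.
have [y [[n _ uny] Fy]] := finite_compact (finite_image u (finite_II N)) PF FN.
by exists y; split=> //; right; exists n.
Qed.

Lemma not_interior_sequence (A : set X) x : frechet_urysohn [set: X] open -> ~ A° x ->
  exists u : nat -> X, (forall n, ~ A (u n)) /\ sp_converges open u x.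
Proof.
move=> FU nAx; apply: (FU (~` A)) => //; split=> // U oU Ux.
apply: contrapT => UA; apply: nAx; rewrite /interior nbhsE; exists U => // y Uy.
by apply: contrapT => nAy; apply: UA; exists y.
Qed.

End Topology.

(** * The Vietoris topology on compact sets *)

Section Vietoris.
Context {X : topologicalType}.
Implicit Types (s t : seq (set X)) (K L : set X).

Lemma vietoris_basic_open s : (forall U, U \in s -> open U) -> vietoris_open (vietoris_basic s).
Proof.
move=> os; split=> [K []//|K sK].
by exists s; split=> //; split=> // L.
Qed.

Lemma union_seq_open s : (forall U, U \in s -> open U) -> open (union_seq s).
Proof.
move=> os; rewrite (_ : union_seq s = \bigcup_(U in [set U | U \in s]) U).
  exact: bigcup_open.
by apply/seteqP; split=> x [U Us Ux]; exists U.
Qed.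

(** Each set of one list is cut down to the union of the other list. *)
Lemma vietoris_basicI s t : (forall U, U \in s -> open U) -> (forall U, U \in t -> open U) ->
  exists2 r, (forall U, U \in r -> open U) &
    vietoris_basic s `&` vietoris_basic t = vietoris_basic r.
Proof.
move=> os ot.
pose r := [seq U `&` union_seq t | U <- s] ++ [seq U `&` union_seq s | U <- t].
have rs U : U \in s -> U `&` union_seq t \in r.
  by move=> Us; rewrite mem_cat; apply/orP; left; apply/mapP; exists U.
have rt U : U \in t -> U `&` union_seq s \in r.
  by move=> Ut; rewrite mem_cat; apply/orP; right; apply/mapP; exists U.
exists r.
  move=> U; rewrite mem_cat => /orP[/mapP[V Vs ->]|/mapP[V Vs ->]].
    by apply: openI; [exact: os|exact: union_seq_open].
  by apply: openI; [exact: ot|exact: union_seq_open].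
apply/seteqP; split=> [K [[KK [Ks sK]] [_ [Kt tK]]]|K [KK [Kr rK]]].
  split=> //; split=> [x Kx|U].
    have [V Vs Vx] := Ks x Kx; exists (V `&` union_seq t); first exact: rs.
    by split=> //; exact: Kt.
  rewrite mem_cat => /orP[/mapP[V Vs ->]|/mapP[V Vs ->]].
    by have [x [Kx Vx]] := sK V Vs; exists x; do 2?split=> //; exact: Kt.
  by have [x [Kx Vx]] := tK V Vs; exists x; do 2?split=> //; exact: Ks.
have rst : union_seq r `<=` union_seq s `&` union_seq t.
  move=> x [U + Ux]; rewrite mem_cat => /orP[/mapP[V Vs UE]|/mapP[V Vs UE]].
    by move: Ux; rewrite UE => -[Vx tx]; split=> //; exists V.
  by move: Ux; rewrite UE => -[Vx tx]; split=> //; exists V.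
split; (split=> //; split=> [x /Kr/rst[]//|U Us]).
  have [|x [Kx [Ux _]]] := rK (U `&` union_seq t); first exact: rs.
  by exists x.
have [|x [Kx [Ux _]]] := rK (U `&` union_seq s); first exact: rt.
by exists x.
Qed.

Lemma vietoris_topology : is_topology (@KX X) (@vietoris_open X).
Proof.
split.
- by move=> U [].
- move=> U V [UK Uo] [_ Vo]; split=> [K [/UK]//|K [UKK VKK]].
  have [s [os [sK sU]]] := Uo K UKK; have [t [ot [tK tV]]] := Vo K VKK.
  have [r or rE] := vietoris_basicI os ot.
  exists r; split=> //; rewrite -rE; split=> // L [sL tL]; split; [exact: sU|exact: tV].
- move=> G GK GP; split=> // K /GP[U [_ Uo] [UK UG]].
  have [s [os [sK sU]]] := Uo K UK; exists s; split=> //; split=> // L sL; exact/UG/sU.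
- split=> // K KK; exists [:: setT]; split; first by move=> U; rewrite inE => /eqP ->; exact: openT.
  split; last by move=> L [].
  split=> //; split=> [x _|U]; first by exists setT; rewrite ?inE.
  by rewrite inE => /eqP ->; rewrite setIT; exact: KK.1.
Qed.

Definition hits (U : set X) := vietoris_basic [:: setT; U].

Lemma hitsE U K : hits U K <-> KX K /\ K `&` U !=set0.
Proof.
split=> [[KK [_ sK]]|[KK KU]]; first by split=> //; apply: sK; rewrite !inE eqxx orbT.
split=> //; split=> [x _|V]; first by exists setT; rewrite ?inE ?eqxx.
rewrite !inE => /orP[/eqP ->|/eqP -> //].
by rewrite setIT; exact: KK.1.
Qed.

Lemma hits_open U : open U -> vietoris_open (hits U).
Proof.
move=> oU; apply: vietoris_basic_open => V; rewrite !inE => /orP[/eqP ->|/eqP ->] //.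
exact: openT.
Qed.

Definition inside (U : set X) := vietoris_basic [:: U].

Lemma insideE U K : inside U K <-> KX K /\ K `<=` U.
Proof.
split=> [[KK [KU _]]|[KK KU]]; first by split=> // x /KU[V]; rewrite inE => /eqP ->.
split=> //; split=> [x /KU Ux|V]; first by exists U; rewrite ?inE.
rewrite inE => /eqP ->; have [x Kx] := KK.1; by exists x; split=> //; exact: KU.
Qed.

Lemma inside_open U : open U -> vietoris_open (inside U).
Proof. by move=> oU; apply: vietoris_basic_open => V; rewrite inE => /eqP ->. Qed.

(** By compactness [K] is covered by finitely many base members inside the sets of [s]. One more
    base member inside each [U] of [s], meeting [K], forces nearby sets to meet [U]. *)
Lemma vietoris_base (B : set (set X)) : sp_base open B ->
  sp_base (@vietoris_open X) [set vietoris_basic s | s in [set s | forall U, U \in s -> B U]].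
Proof.
move=> [Bop Bb]; split=> [_ [s sB <-]|W K [WK Wo] KW].
  by apply: vietoris_basic_open => U /sB/Bop.
have [s [os [[KK [Ks sK]] sW]]] := Wo K KW.
have [_ Kc] := compact_sp_compact KK.2.
have [||t [tB Kt]] := Kc [set P | B P /\ exists2 U, U \in s & P `<=` U].
- by move=> P [/Bop].
- move=> x /Ks[U Us Ux]; have [P BP [Px PU]] := Bb U x (os U Us) Ux.
  by exists P => //; split=> //; exists U.
have /choice[g gP] U : exists P, U \in s -> [/\ B P, P `<=` U & K `&` P !=set0].
  have [Us|] := boolP (U \in s); last by exists set0.
  have [x [Kx Ux]] := sK U Us; have [P BP [Px PU]] := Bb U x (os U Us) Ux.
  by exists P; split=> //; exists x.
(* [t] may contain sets missing [K] *)
pose t' := [seq P <- t | `[< K `&` P !=set0 >]].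
exists (vietoris_basic (t' ++ map g s)).
  exists (t' ++ map g s) => // P; rewrite mem_cat => /orP[|/mapP[U /gP[BP _ _] ->//]].
  by rewrite mem_filter => /andP[_ /tB[]].
split.
  split=> //; split=> [x Kx|P].
    have [P Pt Px] := Kt x Kx; exists P => //; rewrite mem_cat mem_filter Pt andbT.
    by apply/orP; left; apply/asboolP; exists x.
  rewrite mem_cat => /orP[|/mapP[U /gP[_ _ KP] ->//]].
  by rewrite mem_filter => /andP[/asboolP].
move=> L [KL [Lt tL]]; apply: sW; split=> //; split=> [x /Lt[P + Px]|U Us].
  rewrite mem_cat => /orP[|/mapP[U Us PE]]; last first.
    by exists U => //; have [_ PU _] := gP U Us; apply: PU; rewrite -PE.
  by rewrite mem_filter => /andP[_ /tB[_ [U Us PU]]]; exists U => //; exact: PU.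
have [_ PU _] := gP U Us.
have [|x [Lx gx]] := tL (g U); first by rewrite mem_cat map_f ?orbT.
by exists x; split=> //; exact: PU.
Qed.

(** A basic set containing [K] comes from a finite list of base members that all meet [K], and there
    are countably many such lists. *)
Lemma vietoris_base_point_countable (B : set (set X)) : compact_countable [set: X] open B ->
  point_countable (@KX X) [set vietoris_basic s | s in [set s | forall U, U \in s -> B U]].
Proof.
move=> Bc K KK.
have /Bc BK := compact_sp_compact KK.2.
pose next (s : seq (set X)) := [set P | B P /\ P `&` K !=set0].
have : countable (tree next) by apply: tree_countable.
move=> /(countable_image (@vietoris_basic X)); apply: countable_sub.
move=> _ [[s sB <-] [_ [_ sK]]]; exists s => //.
elim: s sB sK => [|P s IHs] sB sK; first exact: tree_nil.
apply: tree_cons; last first.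
  by split; [apply: sB|rewrite setIC; apply: sK]; rewrite inE eqxx.
by apply: IHs => U Us; [apply: sB|apply: sK]; rewrite inE Us orbT.
Qed.

Lemma vietoris_sep K L x : hausdorff_space X -> @regular_space X -> KX K -> KX L ->
  K x -> ~ L x ->
  exists U V, [/\ open U, open V, U x, L `<=` V & U `&` V = set0].
Proof.
move=> H reg KK KL Kx nLx.
have cL : closed L by exact: compact_closed KL.2.
have [|A nA AL] := reg x (~` L).
  by apply: open_nbhs_nbhs; split=> //; exact: closed_openC.
exists A°, (~` closure A); split.
- exact: open_interior.
- exact/closed_openC/closed_closure.
- by [].
- by move=> y Ly /AL.
- by apply/seteqP; split=> // y [/interior_subset/subset_closure].
Qed.

(** If [x] is in [K] and not in [L], disjoint neighbourhoods of [x] and of [L] separate the sets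
    that meet the first from those inside the second. *)
Lemma vietoris_hausdorff K L : hausdorff_space X -> @regular_space X -> KX K -> KX L ->
  K <> L -> exists U V, [/\ vietoris_open U, vietoris_open V, U K, V L & U `&` V = set0].
Proof.
move=> H reg; wlog [x [Kx nLx]] : K L / exists x, K x /\ ~ L x.
  move=> W KK KL KnL.
  have [[x Kx]|nx] := pselect (exists x, K x /\ ~ L x); first by apply: W => //; exists x.
  have [||||U [V [oU oV UL VK UV]]] := W L K => //; last 1 first.
  - by exists V, U; rewrite setIC.
  - apply: contrapT => nx'; apply: KnL; apply/seteqP; split=> x Kx; apply: contrapT => nKx.
      by apply: nx; exists x.
    by apply: nx'; exists x.
  - by move=> /esym.
move=> KK KL _; have [U [V [oU oV Ux LV UV]]] := vietoris_sep H reg KK KL Kx nLx.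
exists (hits U), (inside V); split.
- exact: hits_open.
- exact: inside_open.
- by apply/hitsE; split=> //; exists x.
- exact/insideE.
- apply/seteqP; split=> // M [/hitsE[_ [y [My Uy]]] /insideE[_ MV]].
  have : (U `&` V) y by split=> //; exact: MV.
  by rewrite UV.
Qed.

Lemma KX1 (x : X) : KX [set x].
Proof. by split; [exists x|exact: compact_set1]. Qed.

Lemma F2X_sub_KX (K : set X) : F2X K -> KX K.
Proof.
move=> [a [b ->]]; split; first by exists a; left.
by apply: compactU; exact: compact_set1.
Qed.

Lemma nbhs_all_seq s (x : X) : (forall U, U \in s -> open U /\ U x) ->
  nbhs x [set y | forall U, U \in s -> U y].
Proof.
elim: s => [|V s IHs] sx; first by apply: filterS filterT.
have /IHs xs U : U \in s -> open U /\ U x by move=> Us; apply: sx; rewrite inE Us orbT.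
have xV : nbhs x V by apply: open_nbhs_nbhs; apply: sx; rewrite inE eqxx.
apply: filterS (filterI xs xV) => y [ys yV] U.
by rewrite inE => /predU1P[->|/ys].
Qed.

(** The sets that define a basic neighbourhood of [[set x]] all contain [x], and a neighbourhood
    inside their finite intersection serves as [O]. *)
Lemma vietoris_nbhs_set1 (W : set (set X)) x : vietoris_open W -> W [set x] ->
  exists2 O, open_nbhs x O & forall K, KX K -> K `<=` O -> W K.
Proof.
move=> [_ Wo] /Wo[s [os [[_ [xs sx]] sW]]].
have : nbhs x [set y | forall U, U \in s -> U y].
  by apply: nbhs_all_seq => U Us; split; [exact: os|have [y [->]] := sx U Us].
rewrite nbhsE => -[G xO Os]; exists G => // K KK KO; apply: sW; split=> //.
have [U Us Ux] := xs x erefl.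
split=> [y /KO/Os yU|V Vs]; first by exists U => //; exact: yU.
by have [y Ky] := KK.1; exists y; split=> //; exact: (Os _ (KO y Ky) V Vs).
Qed.

Lemma vietoris_preimage_set1 (W : set (set X)) : vietoris_open W -> open [set x | W [set x]].
Proof.
move=> oW; rewrite openE => x /(vietoris_nbhs_set1 oW)[G xO OW].
rewrite /interior nbhsE; exists G => // y Oy; apply: OW; first exact: KX1.
by move=> _ ->.
Qed.

Lemma open_set1_KX (V : set X) : open V <->
  exists2 W, vietoris_open W & V = [set: X] `&` set1 @^-1` W.
Proof.
split=> [oV|[W oW ->]]; last by rewrite setTI; exact: vietoris_preimage_set1.
exists (inside V); first exact: inside_open.
rewrite setTI; apply/seteqP; split=> x.
  by move=> Vx; apply/insideE; split; [exact: KX1|move=> _ ->].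
by move=> /insideE[_ /(_ x erefl)].
Qed.

Lemma F2_open_KX (V : set (set X)) : F2_open V <->
  exists2 W, vietoris_open W & V = @F2X X `&` id @^-1` W.
Proof. by split=> -[W oW ->]; exists W => //; rewrite setIC. Qed.

Lemma open_set1_F2 (V : set X) : open V <->
  exists2 W, F2_open W & V = [set: X] `&` set1 @^-1` W.
Proof.
split=> [/open_set1_KX[W oW ->]|[_ [W oW ->] ->]].
  exists (W `&` @F2X X); first by exists W.
  rewrite !setTI; apply/seteqP; split=> x; last by case.
  by split=> //; exists x, x; rewrite setUid.
rewrite setTI (_ : _ @^-1` _ = [set x | W [set x]]); first exact: vietoris_preimage_set1.
apply/seteqP; split=> x; first by case.
by split=> //; exists x, x; rewrite setUid.
Qed.

End Vietoris.

(** * Finite unions of network members as neighbourhoods, through [F2X] *)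

Lemma eventually_all_seq {T : eqType} (s : seq T) (Q : T -> nat -> Prop) :
  (forall P, P \in s -> exists J, forall j, (J <= j)%N -> Q P j) ->
  exists J, forall j, (J <= j)%N -> forall P, P \in s -> Q P j.
Proof.
elim: s => [_|P s IHs Qs]; first by exists 0.
have [|J JQ] := IHs; first by move=> R Rs; apply: Qs; rewrite inE Rs orbT.
have [|J' J'Q] := Qs P; first by rewrite inE eqxx.
exists (maxn J J') => j; rewrite geq_max => /andP[Jj J'j] R.
by rewrite inE => /predU1P[->|]; [exact: J'Q|exact: JQ].
Qed.

Section SymmetricSquare.
Context {X : topologicalType} (N : set (set X)).
Hypotheses (H : hausdorff_space X) (FUX : frechet_urysohn [set: X] open).
Hypothesis FU2 : frechet_urysohn (@F2X X) (@F2_open X).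
Hypotheses (Nk : k_network [set: X] open N) (Nc : point_countable [set: X] N).

(* The sequences [tau n] and [y] would span a sequential fan at [x], whose
   symmetric square is not Frechet-Urysohn. *)
Lemma k_network_interior x U : open U -> U x ->
  exists s, [/\ forall P, P \in s -> N P, union_seq s `<=` U & (union_seq s)° x].
Proof.
move=> oU Ux; apply: contrapT => noU.
have {}noU s : (forall P, P \in s -> N P /\ P `<=` U) -> ~ (union_seq s)° x.
  move=> sN sx; apply: noU; exists s; split=> // [P /sN[]//|z [P /sN[_ PU] Pz]].
  exact: PU.
have [|s0 [s0N [xs0 s0U]]] := Nk.2 [set x] U (compact_sp_compact (@compact_set1 _ x)) oU.
  by move=> _ ->.
have s0NU P : P \in s0 -> N P /\ P `<=` U.
  by move=> Ps; split=> [|z Pz]; [exact: s0N|apply: s0U; exists P].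
(* The union of [s0] contains [x] without being a neighbourhood of it, so [y] converges to [x] and
   never takes the value [x]. *)
have [y [ys0 yx]] := not_interior_sequence FUX (noU s0 s0NU).
have ynx n : x <> y n by move=> xE; apply: (ys0 n); apply: xs0.
have [P0 /s0NU P0N _] := xs0 x erefl.
(* [enum t] runs through members of [N] inside [U] and reaches all those that meet [t]; [P0] fills
   the idle indices. *)
have /choice[enum enumP] (t : nat -> X) : exists p : nat -> set X,
    (forall j, N (p j) /\ p j `<=` U) /\
    (forall P, N P -> P `<=` U -> (exists k, P (t k)) -> exists j, p j = P).
  have [|p pP] := @countable_enum _ [set P | N P /\ exists k, P (t k)].
    apply: (@countable_sub _ _ (\bigcup_k [set P | N P /\ P (t k)])).
      by move=> P [NP [k Pk]]; exists k.
    by apply: bigcup_countable => // k _; exact: Nc.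
  exists (fun j => if `[< N (p j) /\ p j `<=` U >] then p j else P0); split=> [j|P NP PU Pt].
    by case: asboolP.
  by have [j jP] := pP P (conj NP Pt); exists j; rewrite jP; case: asboolP => // -[].
(* The sequence [tau n] avoids the first [n] sets listed for each earlier sequence: by [noU] their
   union is not a neighbourhood of [x]. *)
have [tau tauP] : exists tau : nat -> nat -> X, forall n, sp_converges open (tau n) x /\
    forall i j k, (i < n)%N -> (j < n)%N -> ~ enum (tau i) j (tau n k).
  pose R (h : seq (nat -> X)) (t : nat -> X) := sp_converges open t x /\
    forall i j k, (i < size h)%N -> (j < size h)%N -> ~ enum (nth y h i) j (t k).
  have [h|tau tauR] := @history_choice _ R.
    pose s := [seq enum (nth y h i) j | i <- iota 0 (size h), j <- iota 0 (size h)].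
    have [|t [ts tx]] := @not_interior_sequence _ (union_seq s) x FUX.
      by apply: noU => P /allpairsP[[i j] /= [_ _ ->]]; exact: (enumP _).1.
    exists t; split=> // i j k ih jh Pt; apply: (ts k).
    exists (enum (nth y h i) j) => //; apply/allpairsP; exists (i, j).
    by rewrite /= !mem_iota.
  exists tau => n; have [tx tR] := tauR n; split=> // i j k il jl.
  by have := tR i j k; rewrite size_mkseq nth_mkseq //; apply.
pose K nk := [set tau nk.1 nk.2; y nk.1].
have F2K nk : F2X (K nk) by exists (tau nk.1 nk.2), (y nk.1).
(* The pairs accumulate at [[set x]]: choose [n] with [y n] near [x], then [k] with [tau n k] near
   [x]. *)
have [||v [vK vx]] := @FU2 (range K) [set x].
- by move=> _ [nk _ <-].
- split=> [|V [W oW ->] [Wx _]]; first by exists x, x; rewrite setUid.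
  have [G [oO Ox] OW] := vietoris_nbhs_set1 oW Wx.
  have [n yO] := yx G oO Ox; have [k tO] := (tauP n).1 G oO Ox.
  exists (K (n, k)); split; last by exists (n, k).
  split=> //; apply: OW; first exact: F2X_sub_KX.
  by move=> _ [->|->]; [exact: tO|exact: yO].
have /choice[nk nkP] j : exists nk, K nk = v j by have [nk _ nkv] := vK j; exists nk.
pose a j := tau (nk j).1 (nk j).2; pose b j := y (nk j).1.
have abO O : open O -> O x -> exists J, forall j, (J <= j)%N -> O (a j) /\ O (b j).
  move=> oO Ox; have [||J JP] := vx (inside O `&` @F2X X).
  - by exists (inside O) => //; exact: inside_open.
  - split; last by exists x, x; rewrite setUid.
    by apply/insideE; split; [exact: KX1|move=> _ ->].
  exists J => j /JP[/insideE[_ +] _]; rewrite -nkP => vO.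
  by split; apply: vO; [left|right].
have bx : sp_converges open b x by move=> O oO /(abO O oO)[J JP]; exists J => j /JP[].
have ax : sp_converges open a x by move=> O oO /(abO O oO)[J JP]; exists J => j /JP[].
(* Since [b] converges to [x] and no [y m] equals [x], the index of the sequence from which [a j] is
   taken tends to infinity. *)
have nkoo m : exists J, forall j, (J <= j)%N -> (m <= (nk j).1)%N.
  elim: m => [|m [J JP]]; first by exists 0.
  have [J' J'P] := sp_converges_notin (open_T1 H) I I (ynx m) bx.
  exists (maxn J J') => j; rewrite geq_max => /andP[/JP mj /J'P bm].
  by rewrite ltn_neqAle mj andbT; apply/eqP => me; apply: bm; rewrite /b -me.
have [J0 aU] := ax U oU Ux.
have [|s [sN [Ks sU]]] := Nk.2 _ U (converges_compact J0 I (fun=> I) ax) oU.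
  by move=> _ [->//|[j /= /aU + <-]].
(* A set of [s] meeting some [tau i] is [enum (tau i) l] for some [l]; it excludes [a j] once
   [(nk j).1] exceeds [i] and [l]. So [s] cannot cover a tail of [a]. *)
have [|J JP] := @eventually_all_seq _ s (fun P j => ~ P (a j)).
  move=> P Ps; have NP := sN P Ps.
  have PU : P `<=` U by move=> z Pz; apply: sU; exists P.
  have [[i [k Pik]]|nP] := pselect (exists i k, P (tau i k)); last first.
    by exists 0 => j _ Pa; apply: nP; exists (nk j).1, (nk j).2.
  have [l lP] := (enumP (tau i)).2 P NP PU (ex_intro _ k Pik).
  have [J JP] := nkoo (maxn i l).+1.
  exists J => j /JP; rewrite gtn_max => /andP[ij lj].
  by rewrite -lP; exact: (tauP (nk j).1).2.
have [|P Ps Pa] := Ks (a (maxn J0 J)).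
  by right; exists (maxn J0 J) => //=; exact: leq_maxl.
exact: (JP _ (leq_maxr _ _) P Ps Pa).
Qed.

End SymmetricSquare.

(** * A point-countable base from interior covers *)

Section InteriorCovers.
Context {X : topologicalType} (N : set (set X)).
Hypotheses (reg : @regular_space X) (FUX : frechet_urysohn [set: X] open).
Hypothesis Nc : point_countable [set: X] N.
Hypothesis Ni : forall x U, open U -> U x ->
  exists s, [/\ forall P, P \in s -> N P, union_seq s `<=` U & (union_seq s)° x].

(** Minimality concerns the union and not the list, so the union is determined by any sublist that
    still covers [C] with its interior. *)
Definition minimal_cover (C : set X) (F : seq (set X)) :=
  [/\ forall P, P \in F -> N P, C `<=` (union_seq F)° &
    forall s, {subset s <= F} -> C `<=` (union_seq s)° -> union_seq s = union_seq F].

Lemma minimal_covers_countable C :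
  countable [set union_seq F | F in minimal_cover C].
Proof.
have [s nCs|S cS SP] := mishchenko (A := N) (good := fun s => C `<=` (union_seq s)°).
  (* A sequence outside the union of [s] converges to a point of [C] where [s] fails; every good
     list has a member meeting this sequence. *)
  have /nonsubset[x [Cx /= nsx]] := nCs.
  have [u [us ux]] := not_interior_sequence FUX nsx.
  exists (\bigcup_k [set P | N P /\ P (u k)]).
    by apply: bigcup_countable => // k _; exact: Nc.
  move=> F NF CF; have [k uF] := ux _ (open_interior _) (CF x Cx).
  have [P PF Pu] := interior_subset (uF k (leqnn k)).
  exists P; split=> //; last by exists k => //; split=> //; exact: NF.
  by apply/negP => Ps; apply: (us k); exists P.
apply: countable_sub (countable_image (@union_seq X) cS) => _ [F [NF CF Fmin] <-].
by have [s [Ss sF sC]] := SP F NF CF; exists s => //; exact: Fmin.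
Qed.

(** A cover that is not minimal has a sublist with a different union, hence with fewer distinct
    members. *)
Lemma minimal_cover_exists x F : (forall P, P \in F -> N P) -> (union_seq F)° x ->
  exists2 G, minimal_cover [set x] G & union_seq G `<=` union_seq F.
Proof.
have [n] := ubnP (size (undup F)); elim: n F => // n IHn F szF NF Fx.
have [Fmin|nFmin] := pselect (minimal_cover [set x] F); first by exists F.
have [s [sF sx sn]] : exists s, [/\ {subset s <= F}, [set x] `<=` (union_seq s)° &
    union_seq s <> union_seq F].
  apply: contrapT => ns; apply: nFmin; split=> // [_ ->//|s sF sx].
  by apply: contrapT => sn; apply: ns; exists s.
have uF : {subset undup s <= undup F} by move=> P; rewrite !mem_undup; exact: sF.
have [|||G Gmin Gs] := IHn s.
- rewrite -ltnS; apply: leq_trans szF; rewrite ltnS ltnNge; apply/negP => szs.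
  have [_ sE] := uniq_min_size (undup_uniq s) uF szs.
  apply: sn; apply/seteqP; split; apply: union_seq_subset => // P.
  by rewrite -mem_undup -sE mem_undup.
- by move=> P /sF/NF.
- exact: sx.
by exists G => // z /Gs; exact: union_seq_subset.
Qed.

Let V O := \bigcup_(E in [set E : seq (set X) | forall P, P \in E ->
  N P /\ [set union_seq F | F in minimal_cover (closure P)] O]) (union_seq E)°.

(* The Burke--Michael construction: a member [P] of [E] containing a given point
   determines [O] up to countably many choices, and no further information on
   [E] is kept in [V O]. *)
Lemma interior_covers_base : exists B : set (set X), sp_base open B /\ point_countable setT B.
Proof.
exists (range V); split; [split|].
- by move=> _ [G _ <-]; apply: bigcup_open => E _; exact: open_interior.
- move=> U x oU Ux; have [F0 [NF0 F0U F0x]] := Ni oU Ux.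
  have [F [NF Fx Fmin] FF0] := minimal_cover_exists NF0 F0x.
  have [A nA AF] := @reg x _ (open_nbhs_nbhs (conj (open_interior _) (Fx x erefl))).
  have [E0 [NE0 E0A E0x]] := Ni (open_interior A) nA.
  (* Members whose closure misses [x] are dropped. For the others, minimality of [F] for [[set x]]
     passes on to [closure P]. *)
  pose E := [seq P <- E0 | `[< closure P x >]].
  exists (V (union_seq F)); first by exists (union_seq F).
  split.
    exists E.
      move=> P; rewrite mem_filter => /andP[/asboolP Px PE0]; split; first exact: NE0.
      have PF : closure P `<=` (union_seq F)°.
        apply: subset_trans AF; apply: closureS => z Pz.
        by apply: interior_subset; apply: E0A; exists P.
      exists F => //; split=> // s sF Ps; apply: Fmin => // _ ->; exact: Ps.
    have : nbhs x [set z | forall U,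
        U \in [seq ~` closure P | P <- E0 & ~~ `[< closure P x >]] -> U z].
      apply: nbhs_all_seq => U0 /mapP[P]; rewrite mem_filter => /andP[/asboolPn nPx _ ->].
      by split=> //; exact/closed_openC/closed_closure.
    move=> /(filterI E0x); apply: filterS => z [[P PE0 Pz] zE]; exists P => //.
    rewrite mem_filter PE0 andbT; apply: contrapT => /negP nPx.
    apply: (zE (~` closure P)); last exact: subset_closure.
    by apply/mapP; exists P; rewrite // mem_filter nPx.
  (* Every [P] of the list lies inside its minimal cover, whose union is [union_seq F]; so this open
     set stays inside [U]. *)
  move=> z [E' E'P /interior_subset[P PE' Pz]].
  have [_ [F' [_ PF' _] F'F]] := E'P P PE'.
  apply: F0U; apply: FF0; rewrite -F'F; apply: interior_subset.
  by apply: PF'; exact: subset_closure.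
- move=> y _; apply: (@countable_sub _ _ (V @` (\bigcup_(P in [set P | N P /\ P y])
    [set union_seq F | F in minimal_cover (closure P)]))).
    move=> _ [[G _ <-] [E EP /interior_subset[P PE Py]]].
    by exists G => //; have [NP PO] := EP P PE; exists P.
  apply/countable_image/bigcup_countable; first exact: Nc.
  by move=> P _; exact: minimal_covers_countable.
Qed.

End InteriorCovers.

(** * Weak bases with countably many members at each point *)

Section WeakBase.
Context {T : Type} (S : set T) (op : set T -> Prop) (Pw : T -> set (set T)).
Hypotheses (top : is_topology S op) (wb : weak_base S op Pw).
Hypothesis pc : point_countable S (weak_base_family S Pw).

(** The members at [y] all contain [y], so they are countably many; [e n.+1] is taken inside [e n]
    and inside the [n]-th enumerated set, if that is a member at [y]. *)
Lemma weak_base_decreasing y : S y -> exists e : nat -> set T,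
  [/\ forall n, Pw y (e n), forall m n, (m <= n)%N -> e n `<=` e m &
    forall P, Pw y P -> exists n, e n `<=` P].
Proof.
move=> Sy; have [_ [wI [wy [wn _]]]] := wb.
have [|p pP] := @countable_enum _ (Pw y).
  by apply: countable_sub (pc Sy) => P yP; split; [exists y|exact: wy yP].
have [P0 yP0 _] := wn y S Sy (topT top) Sy.
have /choice[h hP] (Ai : set T * nat) : exists R, Pw y Ai.1 ->
    [/\ Pw y R, R `<=` Ai.1 & Pw y (p Ai.2) -> R `<=` p Ai.2].
  have [yA|] := pselect (Pw y Ai.1); last by exists set0.
  have [yp|np] := pselect (Pw y (p Ai.2)); last by exists Ai.1 => _; split=> // /np.
  by have [R yR] := wI y Sy _ _ yA yp; rewrite subsetI => -[RA Rp]; exists R.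
pose e := fix e n := if n is m.+1 then h (e m, m) else P0.
have ye n : Pw y (e n) by elim: n => //= n /(hP (_, n))[].
exists e; split=> // [m n|P yP].
  elim: n => [|n IHn]; first by rewrite leqn0 => /eqP ->.
  rewrite leq_eqVlt => /predU1P[->//|/IHn]; apply: subset_trans.
  by have [] := hP (e n, n) (ye n).
have [i iP] := pP P yP; exists i.+1 => /=.
by have [_ _] := hP (e i, i) (ye i); rewrite /= iP; apply.
Qed.

Lemma weak_base_converges y (u : nat -> T) : S y ->
  (forall U, Pw y U -> exists N, forall n, (N <= n)%N -> U (u n)) -> sp_converges op u y.
Proof.
move=> Sy H U opU Uy; have [_ [_ [_ [wn _]]]] := wb.
have [P /H[N uN] PU] := wn y U Sy opU Uy.
by exists N => n /uN /PU.
Qed.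

Definition sp_hausdorff := forall x y, S x -> S y -> x <> y ->
  exists U V, [/\ op U, op V, U x, V y & U `&` V = set0].

(** The terms outside [P] form a set with open complement by the weak base criterion; this
    complement contains [y], so the sequence ends up in it. *)
Lemma weak_base_eventually y (u : nat -> T) P : sp_hausdorff ->
  S y -> (forall n, S (u n)) -> sp_converges op u y -> Pw y P ->
  exists N, forall n, (N <= n)%N -> P (u n).
Proof.
move=> hd Sy Su uy yP; have [wS [wI [wy [wn wo]]]] := wb.
pose A := [set u n | n in [set n | ~ P (u n)]].
have oA : op (S `\` A).
  apply: wo => [z []//|z [Sz nAz]].
  have [->|zy] := pselect (z = y).
    by exists P => // x Px; split; [exact: wS Sy yP _ Px|move=> [n nP nx]; apply: nP; rewrite nx].
  have [U [V [opU opV Uz Vy UV]]] := hd z y Sz Sy zy.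
  have [N uN] := uy V opV Vy.
  (* Terms from [N] on lie in [V], away from [U]; the earlier ones outside [P] are removed one at a
     time by induction on [N]. *)
  suff [W zW WA] : exists2 W, Pw z W &
      W `<=` U /\ forall n, (n < N)%N -> ~ P (u n) -> ~ W (u n).
    exists W => // x Wx; split; first exact: wS Sz zW _ Wx.
    move=> [n nP nx]; have [/uN Vun|nN] := leqP N n.
      have : (U `&` V) (u n) by split=> //; rewrite nx; exact: WA.1.
      by rewrite UV.
    by apply: (WA.2 n nN nP); rewrite nx.
  elim: N {uN} => [|N [W zW [WU WP]]]; first by have [W] := wn z U Sz opU Uz; exists W.
  have [PuN|nPuN] := pselect (P (u N)).
    exists W => //; split=> // n; rewrite ltnS leq_eqVlt => /predU1P[->//|]; exact: WP.
  have zuN : z <> u N by move=> zE; apply: nAz; exists N.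
  have [U' [V' [opU' opV' U'z V'u UV']]] := hd z (u N) Sz (Su N) zuN.
  have [W' zW' W'U'] := wn z U' Sz opU' U'z.
  have [W'' zW''] := wI z Sz _ _ zW zW'; rewrite subsetI => -[W''W W''W'].
  exists W'' => //; split; first exact: subset_trans WU.
  move=> n; rewrite ltnS leq_eqVlt => /predU1P[-> _|nN nP].
    move=> /W''W'/W'U' U'u; have : (U' `&` V') (u N) by [].
    by rewrite UV'.
  by move=> /W''W; exact: WP.
have nAy : (S `\` A) y by split=> // -[n nP ny]; apply: nP; rewrite ny; exact: wy yP.
have [N uN] := uy _ oA nAy.
by exists N => n /uN[_ nA]; apply: contrapT => nP; apply: nA; exists n.
Qed.

Lemma weak_base_base :
  (forall x Q, S x -> Pw x Q -> exists2 U, op U & U x /\ U `<=` Q) ->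
  exists B, sp_base op B /\ point_countable S B.
Proof.
move=> nb; have [wS [wI [wy [wn wo]]]] := wb.
pose int Q := \bigcup_(U in [set U | op U /\ U `<=` Q]) U.
have intQ Q : int Q `<=` Q by move=> x [U [_ UQ] /UQ].
exists [set int Q | Q in weak_base_family S Pw]; split; [split|].
- move=> _ [Q [y Sy yQ] <-]; apply: (top_local top).
    by move=> x /intQ; exact: wS yQ x.
  by move=> x [U [oU UQ] Ux]; exists U => //; split=> // z Uz; exists U.
- move=> U x oU Ux; have Sx := top_sub top oU Ux.
  have [Q xQ QU] := wn x U Sx oU Ux.
  exists (int Q); first by exists Q => //; exists x.
  split; last exact: subset_trans QU.
  by have [V oV [Vx VQ]] := nb x Q Sx xQ; exists V.
- move=> x Sx; apply: countable_sub (countable_image int (pc Sx)).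
  by move=> _ [[Q FQ <-] /intQ Qx]; exists Q.
Qed.

End WeakBase.

(** * The weak base of [X] induced on singletons *)

Section SingletonWeakBase.
Context {X : topologicalType} (Pw : set X -> set (set (set X))).
Hypotheses (H : hausdorff_space X) (wb : weak_base (@KX X) (@vietoris_open X) Pw).

Definition singleton_weak_base (x : X) : set (set X) :=
  [set [set z | P [set z]] | P in Pw [set x]].

Lemma singleton_weak_base_point_countable :
  point_countable (@KX X) (weak_base_family (@KX X) Pw) ->
  point_countable setT (weak_base_family setT singleton_weak_base).
Proof.
move=> pc x _; pose f (P : set (set X)) := [set z | P [set z]].
apply: countable_sub (countable_image f (pc [set x] (KX1 x))).
move=> _ [[y _ [P yP <-]] Px]; exists P => //; split=> //.
by exists [set y] => //; exact: KX1.
Qed.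

Lemma singleton_weak_baseP : weak_base setT open singleton_weak_base.
Proof.
have [wS [wI [wy [wn wo]]]] := wb.
do !split=> //.
- move=> x _ _ _ [P xP <-] [Q xQ <-].
  have [R xR RPQ] := wI _ (KX1 x) _ _ xP xQ.
  by exists [set z | R [set z]]; [exists R|move=> z /RPQ].
- by move=> x _ _ [P /(wy _ (KX1 x)) + <-].
- move=> x U _ oU Ux.
  have [||P xP PU] := wn [set x] (inside U) (KX1 x); first exact: inside_open.
    by apply/insideE; split; [exact: KX1|move=> _ ->].
  exists [set z | P [set z]]; first by exists P.
  by move=> z /PU/insideE[_]; apply.
- move=> G _ GP.
  (* Sets with several points belong to this family whatever [G] is. *)
  have oG : vietoris_open [set K | KX K /\ forall x, K = [set x] -> G x].
    apply: wo => [K []//|K [KK KG]].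
    have [[x Kx]|nK] := pselect (exists x, K = [set x]).
      have [_ [P xP <-] PG] := GP x (KG x Kx).
      exists P; first by rewrite Kx.
      move=> L PL; split; first exact: (wS _ _ (KX1 x) xP).
      by move=> z LE; apply: PG; rewrite /= -LE.
    have [x Kx] := KK.1.
    have [y [Ky yx]] : exists y, K y /\ y <> x.
      apply: contrapT => ny; apply: nK; exists x; apply/seteqP; split=> [y Ky|_ -> //].
      by apply: contrapT => yx; apply: ny; exists y.
    (* No singleton meets two disjoint open sets, so some neighbourhood of [K] has only sets with
       several points. *)
    have [U [V [oU oV Uy Vx UV]]] := hausdorff_sep H yx.
    have [||P KP PUV] := wn K (hits U `&` hits V) KK.
    + by apply: (topI vietoris_topology); exact: hits_open.
    + by split; apply/hitsE; split=> //; [exists y|exists x].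
    exists P => // L /PUV[/hitsE[KL [a [La Ua]]] /hitsE[_ [b [Lb Vb]]]].
    split=> // z LE; move: La Lb; rewrite LE => az bz; exfalso.
    by rewrite -[False]/(set0 z) -UV; split; [rewrite -az|rewrite -bz].
  rewrite (_ : G = [set x | [set K | KX K /\ forall x, K = [set x] -> G x] [set x]]).
    exact: vietoris_preimage_set1.
  apply/seteqP; split=> [x Gx|x [_]]; last exact.
  split; first exact: KX1.
  by move=> z zx; rewrite -(_ : x = z) // -[x = z]/([set z] x) -zx.
Qed.

End SingletonWeakBase.

(** * Weak neighbourhoods in [X] are neighbourhoods *)

Section WeakNeighbourhoods.
Context {X : topologicalType} (Pw : X -> set (set X)) (PK : set X -> set (set (set X))).
Hypotheses (H : hausdorff_space X) (reg : @regular_space X).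
Hypotheses (wb : weak_base setT open Pw) (pc : point_countable setT (weak_base_family setT Pw)).
Hypotheses (wbK : weak_base (@KX X) (@vietoris_open X) PK)
  (pcK : point_countable (@KX X) (weak_base_family (@KX X) PK)).

(* The points [x], [xs n], [z n m] form a copy of Arens' space [S_2]; it produces
   a sequential fan in the hyperspace, at the point [x |` range xs]. *)
Lemma arens_hyperspace x Q (xs : nat -> X) (z : nat -> nat -> X) :
  sp_converges open xs x -> (forall n, sp_converges open (z n) (xs n)) ->
  (exists2 P, Pw x P & P `<=` Q) -> (forall n, Q (xs n)) -> (forall n m, ~ Q (z n m)) -> False.
Proof.
move=> xsx zxs [P0 xP0 P0Q] Qxs nQz.
have [_ [wI [wy [wn wo]]]] := wb.
pose K0 := x |` range xs.
have K0K : KX K0 by split; [exists x; left|exact: compact_sequence].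
pose L n m := K0 `|` [set z n m].
have LK n m : KX (L n m).
  split; first by exists x; left; left.
  by apply: compactU; [exact: K0K.2|exact: compact_set1].
have LK0 n : sp_converges (@vietoris_open X) (L n) K0.
  move=> W [_ Wo] /Wo[s [os [[_ [K0s sK0]] sW]]].
  (* A set of the list that contains [xs n] also takes in [z n m] for large [m]. *)
  have [U Us Ux] := K0s (xs n) (or_intror (ex_intro2 _ _ n I erefl)).
  have [N zN] := zxs n U (os U Us) Ux.
  exists N => m /zN Uz; apply: sW; split=> //; split.
    by move=> y [/K0s//|->]; exists U.
  by move=> V /sK0[y [K0y Vy]]; exists y; split=> //; left.
have [R [RK Rdec Rn]] := weak_base_decreasing vietoris_topology wbK pcK K0K.
have hdK : sp_hausdorff (@KX X) (@vietoris_open X).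
  by move=> K M KK KM; exact: vietoris_hausdorff.
have RL n : exists M, forall m, (M <= m)%N -> R n (L n m).
  exact (weak_base_eventually wbK hdK K0K (LK n) (LK0 n) (RK n)).
have [|p pP] := @countable_enum _ [set P | weak_base_family setT Pw P /\ exists n m, P (z n m)].
  apply: (@countable_sub _ _
      (\bigcup_n \bigcup_m [set P | weak_base_family setT Pw P /\ P (z n m)])).
    by move=> P [FP [n [m Pz]]]; exists n => //; exists m.
  by do 2![apply: bigcup_countable => // ? _]; exact: pc.
(* [leaves] is a verb: [z n] is eventually outside [P]. *)
pose leaves (P : set X) n := exists M, forall m, (M <= m)%N -> ~ P (z n m).
(* [d n] is large enough for [L n (d n)] to be in [R n], and for [z n (d n)] to avoid those of
   [p 0], ..., [p n] that [z n] leaves. *)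
have /choice[d dP] n : exists m, R n (L n m) /\
    forall i, (i <= n)%N -> leaves (p i) n -> ~ p i (z n m).
  have [M RM] := RL n.
  have [|M' M'P] := @eventually_all_seq _ (iota 0 n.+1)
      (fun i m => leaves (p i) n -> ~ p i (z n m)).
    move=> i _; have [[M' M'P]|nl] := pselect (leaves (p i) n); last by exists 0.
    by exists M' => m /M'P.
  exists (maxn M M'); split; first exact: RM (leq_maxl _ _).
  by move=> i ilen; apply: M'P (leq_maxr _ _) _ _; rewrite mem_iota.
pose D := range (fun n => z n (d n)).
have oD : open (~` D).
  apply: wo => // y nDy; have [->|yx] := pselect (y = x).
    by exists P0 => // t /P0Q Qt [n _ zt]; apply: (nQz n (d n)); rewrite zt.
  have [U [V [oU oV Uy Vx UV]]] := hausdorff_sep H yx.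
  have [P yP PU] := wn y U I oU Uy.
  have [[n0 [m0 Pz]]|nP] := pselect (exists n m, P (z n m)); last first.
    by exists P => // t Pt [n _ zt]; apply: nP; exists n, (d n); rewrite zt.
  have [i iP] : exists i, p i = P.
    by apply: pP; split; [exists y|exists n0, m0].
  have [N xsN] := xsx V oV Vx.
  (* From [N] on, [xs n] is in [V], so [z n] leaves [P], which lies in [U]; from [i] on the choice
     of [d n] then applies to [P]. *)
  have PD n : (maxn N i <= n)%N -> ~ P (z n (d n)).
    rewrite geq_max => /andP[Nn ilen]; rewrite -iP; apply: (dP n).2 ilen _; rewrite iP.
    have [M zM] := zxs n V oV (xsN n Nn).
    exists M => m /zM Vz /PU Uz; have : (U `&` V) (z n m) by [].
    by rewrite UV.
  pose s := [seq ~` [set z n (d n)] | n <- iota 0 (maxn N i)].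
  have : nbhs y [set t | forall A, A \in s -> A t].
    apply: nbhs_all_seq => A /mapP[n _ ->]; split; first exact: hausdorff_openC1.
    by move=> yz; apply: nDy; exists n.
  rewrite nbhsE => -[G [oG Gy] Gs].
  have [P' yP' P'G] := wn y G I oG Gy.
  have [P'' yP''] := wI y I _ _ yP yP'; rewrite subsetI => -[P''P P''P'].
  exists P'' => // t P''t [n _ zt]; have [ge|lt] := leqP (maxn N i) n.
    by apply: (PD n ge); rewrite zt; exact: P''P.
  have tG : G t by exact/P'G/P''P'.
  apply: (Gs t tG (~` [set z n (d n)])); last by rewrite /= zt.
  by apply/mapP; exists n; rewrite // mem_iota.
have K0D : inside (~` D) K0.
  apply/insideE; split=> // t tK0 [n _ zt]; apply: (nQz n (d n)); rewrite zt.
  by case: tK0 => [->|[k _ <-]//]; apply: P0Q; exact: wy xP0.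
(* A weak neighbourhood of [K0] whose members avoid [D] would contain some [R n], hence [L n (d n)],
   which meets [D]. *)
have [P K0P PD] := wbK.2.2.2.1 K0 _ K0K (inside_open oD) K0D.
have [n RnP] := Rn P K0P.
have /insideE[_ LD] := PD _ (RnP _ (dP n).1).
by apply: (LD (z n (d n))); [right|exists n].
Qed.

(** Let [G] be the set of points at which [Q] contains a weak neighbourhood. If [G] were not open,
    points of [Q] outside [G] would converge to some [y] in [G], and each would be a limit of points
    outside [Q], as [arens_hyperspace] forbids. *)
Lemma weak_base_nbhs x Q : Pw x Q -> exists2 U, open U & U x /\ U `<=` Q.
Proof.
move=> xQ; have [_ [wI [wy [wn wo]]]] := wb.
pose G := [set y | exists2 P, Pw y P & P `<=` Q].
have GQ : G `<=` Q by move=> y [P yP PQ]; apply: PQ; exact: wy yP.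
apply: contrapT => nU; have [y Gy nyG] : exists2 y, G y & forall P, Pw y P -> ~ P `<=` G.
  apply: contrapT => ny; apply: nU; exists G; last by split=> //; exists Q.
  apply: wo => // y Gy; apply: contrapT => nP; apply: ny; exists y => // P yP PG.
  by apply: nP; exists P.
have [P yP PQ] := Gy.
have [e [ye edec en]] := weak_base_decreasing open_topology wb pc (y := y) I.
have /choice[xs xsP] n : exists t, [/\ e n t, Q t & ~ G t].
  have [R yR] := wI y I _ _ yP (ye n); rewrite subsetI => -[RP Re].
  have /nonsubset[t [Rt nGt]] := nyG R yR.
  by exists t; split=> //; [exact: Re|exact/PQ/RP].
have /choice[z zP] n : exists u : nat -> X, sp_converges open u (xs n) /\ forall m, ~ Q (u m).
  have [f [xf fdec fn]] := weak_base_decreasing open_topology wb pc (y := xs n) I.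
  have /choice[u uP] m : exists t, f m t /\ ~ Q t.
    have [_ _ nG] := xsP n.
    by apply/nonsubset => fQ; apply: nG; exists (f m).
  exists u; split=> [|m]; last exact: (uP m).2.
  apply: (weak_base_converges wb) => // V /fn[N NV].
  by exists N => m Nm; apply/NV/(fdec _ _ Nm); exact: (uP m).1.
apply: (@arens_hyperspace y Q xs z) => //.
- apply: (weak_base_converges wb) => // V /en[N NV].
  by exists N => n Nn; apply/NV/(edec _ _ Nn); have [] := xsP n.
- by move=> n; exact: (zP n).1.
- by move=> n; have [] := xsP n.
- by move=> n; exact: (zP n).2.
Qed.

End WeakNeighbourhoods.

(** * The equivalences, by two cycles of implications *)

Unset Implicit Arguments.

Theorem theorem3p11 (X : topologicalType) :
  hausdorff_space X -> @regular_space X ->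
  let c1 := exists B : set (set X),
      sp_base open B /\ point_countable setT B in
  let c2 := frechet_urysohn (@F2X X) (@F2_open X) /\
      exists N, k_network (@F2X X) (@F2_open X) N /\ point_countable (@F2X X) N in
  let c3 := frechet_urysohn (@KX X) (@vietoris_open X) /\
      exists N, k_network (@KX X) (@vietoris_open X) N /\ point_countable (@KX X) N in
  let c4 := exists Pw, weak_base (@KX X) (@vietoris_open X) Pw /\
      point_countable (@KX X) (weak_base_family (@KX X) Pw) in
  let c5 := exists Pw, weak_base (@KX X) (@vietoris_open X) Pw /\
      compact_countable (@KX X) (@vietoris_open X) (weak_base_family (@KX X) Pw) in
  let c6 := exists B, sp_base (@vietoris_open X) B /\ point_countable (@KX X) B in
  [/\ (c1 <-> c2), (c1 <-> c3), (c1 <-> c4), (c1 <-> c5) & (c1 <-> c6)].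
Proof.
move=> H reg c1 c2 c3 c4 c5 c6.
have T1K : sp_T1 (@KX X) (@vietoris_open X).
  move=> K L KK KL KnL.
  have [U [V [oU _ UK VL UV]]] := vietoris_hausdorff H reg KK KL KnL.
  exists U => //; split=> // UL.
  by rewrite -[False]/(set0 L) -UV.
have c16 : c1 -> c6.
  move=> [B [Bb Bc]]; exists [set vietoris_basic s | s in [set s | forall U, U \in s -> B U]].
  split; first exact: vietoris_base.
  apply: vietoris_base_point_countable.
  exact: (base_compact_countable (open_T1 H) Bb Bc).
have c65 : c6 -> c5.
  move=> [B [Bb Bc]]; exists (fun y => [set P | B P /\ P y]).
  split; first exact (base_weak_base vietoris_topology Bb).
  move=> K Kc; apply: countable_sub (base_compact_countable T1K Bb Bc Kc).
  by move=> P [[y _ [BP _]] PK].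
have c54 : c5 -> c4.
  by move=> [Pw [wb cc]]; exists Pw; split=> //; exact: (compact_countable_point cc).
have c41 : c4 -> c1.
  move=> [PK [wbK pcK]].
  have wb := singleton_weak_baseP H wbK; have pc := singleton_weak_base_point_countable pcK.
  apply: (weak_base_base open_topology wb pc) => x Q _ xQ.
  exact (weak_base_nbhs H reg wb pc wbK pcK xQ).
have c63 : c6 -> c3.
  move=> [B [Bb Bc]]; split; first exact: (base_frechet vietoris_topology Bb Bc).
  by exists B; split=> //; exact: (base_k_network vietoris_topology Bb).
have c32 : c3 -> c2.
  move=> [FU [N [Nk Nc]]]; split.
    exact: (frechet_pullback (@F2X_sub_KX X) (@F2_open_KX X) FU).
  exists [set @F2X X `&` id @^-1` P | P in N].
  exact: (k_network_pullback (@F2X_sub_KX X) (@F2_open_KX X) Nk Nc).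
have c21 : c2 -> c1.
  move=> [FU [N [Nk Nc]]].
  have sF x : [set: X] x -> F2X [set x] by exists x, x; rewrite setUid.
  have FUX := frechet_pullback sF (@open_set1_F2 X) FU.
  have [N'k N'c] := k_network_pullback sF (@open_set1_F2 X) Nk Nc.
  apply: (interior_covers_base reg FUX N'c) => x U oU Ux.
  exact: (k_network_interior H FUX FU N'k N'c oU Ux).
by split; tauto.
Qed.
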